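(* Let $\mathbb B$ be a Brownian motion, $\mathbb M(\lambda)=\mathbb B(\lambda)^2-\lambda$, $\alpha\ge1$, and consider the random variables $$\mathbb W_\alpha=\Big(\int_0^1\lambda^\alpha\big(\mathbb M(\lambda)-\lambda^2\mathbb M(1)\big)^2\mathrm d\lambda\Big)^{1/2},\qquad\mathbb H_\alpha=\mathbb M(1)/\mathbb W_\alpha .$$ Then, for sufficiently large $t$, the following bounds hold: (i) $\mathbb E[\exp(-t\,\mathbb W_\alpha^2)]\le9\exp(-C_\alpha t^{1/4})$, (ii) $\mathbb P(|\mathbb H_\alpha|>t)\le11\exp(-D_\alpha t^{2/5})$, where $C_\alpha=(16(\alpha+3))^{-1}$ and $D_\alpha=3\cdot(C_\alpha/4)^{4/3}$.
   Context: $\mathbb B$ is a standard Brownian motion on $[0,1]$. *)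

(* Defs.v *)
From HB Require Import structures.
From mathcomp Require Import all_boot all_order all_algebra.
From mathcomp Require Import all_classical all_reals all_analysis.
From mathcomp Require Import measurable_realfun.

Set Implicit Arguments.
Unset Strict Implicit.
Unset Printing Implicit Defensive.

Import Order.TTheory GRing.Theory Num.Theory.
Import numFieldNormedType.Exports.

Local Open Scope classical_set_scope.
Local Open Scope ring_scope.

(* The A i range over all measurable sets, [setT] included, so the product rule
   for the whole family contains the one for each subfamily. *)
Definition mutually_independent (R : realType) (d : measure_display)
    (T : measurableType d) (P : probability T R) (I : finType)
    (X : I -> {RV P >-> R}) : Prop :=
  forall A : I -> set R, (forall i, measurable (A i)) ->
    P (\bigcap_i (X i @^-1` A i)) = (\prod_i P (X i @^-1` A i))%E.
Arguments mutually_independent {R d T} P {I} X.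

(* Only the values of B on `[0, 1] are constrained; B is indexed by R for
   convenience. The second parameter of [normal_prob] is the standard
   deviation, and it does not denote a Dirac mass when it is 0, hence s < t. *)
Record standard_brownian_motion01 (R : realType) (d : measure_display)
    (T : measurableType d) (P : probability T R) (B : R -> {RV P >-> R}) :
    Prop := StandardBrownianMotion01 {
  brownian_start : {ae P, forall w, B 0 w = 0} ;
  brownian_increment : forall s t : R, 0 <= s -> s < t -> t <= 1 ->
    forall A : set R, measurable A ->
      distribution P (B t \- B s) A
      = normal_prob 0 (Num.sqrt (t - s)) A ;
  brownian_independent : forall (n : nat) (t : nat -> R),
    0 <= t 0%N -> (forall i, (i < n)%N -> t i < t i.+1) -> t n <= 1 ->
    mutually_independent P (fun i : 'I_n => B (t i.+1) \- B (t i)) ;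
  brownian_continuous : forall w : T,
    {within `[0, 1], continuous (fun t : R => B t w)}
}.
Arguments standard_brownian_motion01 {R d T} P B.

Section functionals.
Context (R : realType) (d : measure_display) (T : measurableType d).
Variable B : R -> {mfun T >-> R}.

Definition procM (l : R) (w : T) : R := B l w ^+ 2 - l.

Definition rvW (alpha : R) (w : T) : R :=
  Num.sqrt (\int[lebesgue_measure]_(l in `[0, 1])
    (l `^ alpha * (procM l w - l ^+ 2 * procM 1 w) ^+ 2)).

(* Equal to 0 where [rvW alpha w = 0], since [x / 0 = 0]. *)
Definition rvH (alpha : R) (w : T) : R := procM 1 w / rvW alpha w.

End functionals.

Definition constC (R : realType) (alpha : R) : R := (16 * (alpha + 3))^-1.

Definition constD (R : realType) (alpha : R) : R :=
  3 * (constC alpha / 4) `^ (4 / 3).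

(* Main.v *)
Require Import Defs.
From HB Require Import structures.
From mathcomp Require Import all_boot all_order all_algebra.
From mathcomp Require Import all_classical all_reals all_analysis.
From mathcomp Require Import measurable_realfun.
From mathcomp Require Import ring lra zify.

Set Implicit Arguments.
Unset Strict Implicit.
Unset Printing Implicit Defensive.

Import Order.TTheory GRing.Theory Num.Theory.
Import numFieldNormedType.Exports.

Local Open Scope classical_set_scope.
Local Open Scope ring_scope.

(* On a grid of mesh h the drift l + l^2 M(1) in M(l) - l^2 M(1) =
   B(l)^2 - l - l^2 M(1) is killed by third differences, so
   W^2 dominates the average, over the position of a grid with 4n points in
   [1/2, 1] and h = 1/(8n), of a multiple of h times the sum of the squares of n
   third differences of B^2, taken over disjoint blocks. By Jensen and Tonelli it
   suffices to bound the Laplace transform for a fixed grid. Conditionally on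
   the past, the last point of a block is b + X with X ~ N(0, h), and
   E exp(- tau (a - (b + X)^2)^2) <= 1/2 uniformly in a and b once tau h^2 is
   large, because the density of X is at most h^(-1/2). Hence
   E exp(- t W^2) <= 2^-n as soon as t >= K n^3, a rate t^(1/3) that beats
   t^(1/4). For (ii), split according to |M(1)| <= t^(1/2), use Gaussian tails
   and the exponential Markov inequality with n ~ t^(2/5). *)

(** * Small balls of a Gaussian *)

(** The density is at most its peak [1 / (s * sqrt (2 * pi)) <= 1 / s], and the interval has length
    [2 * r]. *)
Lemma normal_prob_itv_le (R : realType) (s m r : R) : 0 < s -> 0 < r ->
  (normal_prob 0 s `[(m - r)%R, (m + r)%R] <= (2 * r / s)%:E)%E.
Proof.
move=> s0 r0.
have peak : normal_peak s <= s^-1.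
  rewrite /normal_peak lef_pV2 ?posrE//; last first.
    by rewrite sqrtr_gt0 pmulrn_lgt0// mulr_gt0 ?pi_gt0// exprn_gt0.
  rewrite -[leLHS](ger0_norm (ltW s0)) -sqrtr_sqr ler_wsqrtr// -mulrnAr.
  rewrite ler_peMr ?sqr_ge0//.
  by have := @pi_ge2 R; lra.
rewrite /normal_prob.
apply: (@le_trans _ _ (\int[lebesgue_measure]_(x in `[(m - r)%R, (m + r)%R])
    (cst (s^-1)%:E x))%E).
  apply: ge0_le_integral => //=.
  - by move=> x _; rewrite lee_fin normal_pdf_ge0.
  - apply/measurable_EFinP/measurable_funTS; exact: measurable_normal_pdf.
  - move=> x _; rewrite lee_fin (le_trans _ peak)//.
    by apply: normal_pdf_ub; rewrite gt_eqF.
rewrite integral_cst//= lebesgue_measure_itv/= lte_fin ifT; last by lra.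
by rewrite -EFinD -EFinM lee_fin; rewrite le_eqVlt; apply/predU1P; left; ring.
Qed.

(* The two real square roots of [a] (both 0 if [a <= 0]) are [+- Num.sqrt a];
   away from them [(a - y^2)^2] is at least the fourth power of the distance. *)
Lemma sqr_dist_sqr_ge (R : realType) (a y r : R) : 0 <= r ->
  r <= `|y - Num.sqrt a| -> r <= `|y + Num.sqrt a| ->
  r ^+ 4 <= (a - y ^+ 2) ^+ 2.
Proof.
move=> r0 h1 h2.
have q0 : 0 <= Num.sqrt a := sqrtr_ge0 a.
have prod : r ^+ 2 <= `|y ^+ 2 - Num.sqrt a ^+ 2|.
  by rewrite subr_sqr normrM expr2 ler_pM.
have : r ^+ 2 <= `|a - y ^+ 2|.
  have [a0|a0] := leP 0 a; first by move: prod; rewrite sqr_sqrtr// distrC.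
  apply: (le_trans prod); rewrite ler0_sqrtr ?(ltW a0)//.
  by rewrite expr0n/= subr0 ger0_norm ?sqr_ge0// ler0_norm; nra.
move=> le2; rewrite -[leRHS]real_normK ?num_real// (exprM r 2 2).
by rewrite lerXn2r// nnegrE exprn_ge0.
Qed.

(** Where [b + x] is within [r = s / 16] of one of the points [q], [- q], the integrand is bounded
    by 1; each of these two intervals has mass at most [1 / 8]. Elsewhere the exponent is at least 3
    and the integrand at most [1 / 4]. The total is [1 / 4 + 1 / 8 + 1 / 8]. *)
Lemma integral_normal_expR_quartic_le (R : realType) (a b s tau : R) :
  0 < s -> 0 <= tau -> 3 <= tau * (s / 16) ^+ 4 ->
  (\int[normal_prob 0 s]_x (expR (- (tau * (a - (b + x) ^+ 2) ^+ 2)))%:E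
   <= (2^-1)%:E)%E.
Proof.
move=> s0 tau0 htau; set r := s / 16; set q := Num.sqrt a.
have r0 : 0 < r by rewrite divr_gt0.
pose I m : set R := `[m - r, m + r]%classic.
pose g x : R := 4^-1 + (\1_(I (q - b)) x + \1_(I (- q - b)) x).
have mg m : measurable_fun [set: R] (fun x => (\1_(I m) x)%:E : \bar R).
  by apply/measurable_EFinP; apply: measurable_indic; exact: measurable_itv.
apply: (@le_trans _ _ (\int[normal_prob 0 s]_x (g x)%:E)%E).
  apply: ge0_le_integral => //=.
  - apply/measurable_EFinP; apply: measurableT_comp => //.
    apply: measurableT_comp => //; apply: measurable_funM => //.
    apply: measurable_funX; apply: measurable_funB => //.
    by apply: measurable_funX; exact: measurable_funD.
  - apply/measurable_EFinP; apply: measurable_funD => //.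
    by apply: measurable_funD; apply: measurable_indic; exact: measurable_itv.
  move=> x _; rewrite lee_fin /g.
  have e1 : expR (- (tau * (a - (b + x) ^+ 2) ^+ 2)) <= 1.
    by rewrite -[leRHS]expR0 ler_expR oppr_le0 mulr_ge0// sqr_ge0.
  have i0 m : 0 <= \1_(I m) x :> R by [].
  have one m : x \in I m -> \1_(I m) x = 1 :> R by move=> xm; rewrite indicE xm.
  have [x1|x1] := boolP (x \in I (q - b)).
    by rewrite (le_trans e1)// (one _ x1) addrCA lerDl addr_ge0.
  have [x2|x2] := boolP (x \in I (- q - b)).
    by rewrite (le_trans e1)// (one _ x2) addrA lerDr addr_ge0.
  have far m : x \notin I m -> r <= `|x - m|.
    move=> xm; rewrite leNgt; apply/negP => xr; move/negP: xm; apply.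
    by rewrite inE /I/= in_itv/= -ler_distl ltW.
  have := @sqr_dist_sqr_ge R a (b + x) r (ltW r0).
  have := far _ x1; have := far _ x2.
  have -> : x - (- q - b) = b + x + q by ring.
  have -> : x - (q - b) = b + x - q by ring.
  move=> f2 f1 /(_ f1 f2) dist.
  rewrite (@le_trans _ _ 4^-1) ?lerDl ?addr_ge0//.
  (* From [1 + y <= expR y], an exponent [y >= 3] gives [expR (- y) <= 1 / 4]. *)
  rewrite expRN lef_pV2 ?posrE ?expR_gt0//.
  apply: le_trans (expR_ge1Dx _).
  have : tau * r ^+ 4 <= tau * (a - (b + x) ^+ 2) ^+ 2 by rewrite ler_wpM2l.
  by move: htau; rewrite -/r; lra.
under eq_integral do rewrite EFinD EFinD.
rewrite ge0_integralD//; last 2 first.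
- by move=> x _; rewrite adde_ge0// lee_fin.
- by apply: emeasurable_funD; exact: mg.
rewrite ge0_integralD//; last 2 first.
- exact: mg.
- exact: mg.
rewrite integral_cst// !integral_indic ?setIT//; last 2 first.
- exact: measurable_itv.
- exact: measurable_itv.
rewrite (_ : (_ * _)%E = (4^-1)%:E); last first.
  by rewrite -[RHS]mule1; congr (_ * _)%E;
    exact: (@probability_setT _ _ _ (normal_prob 0 s)).
have := @normal_prob_itv_le R s (q - b) r s0 r0.
have := @normal_prob_itv_le R s (- q - b) r s0 r0.
move=> h2 h1; apply: (le_trans (leeD (lexx _) (leeD h1 h2))).
rewrite -!EFinD lee_fin /r.
have -> : 2 * (s / 16) / s = 8^-1 by field; rewrite gt_eqF.
by lra.
Qed.

(** * Conditioning on an independent past *)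

Section independent_of_pi_system.
Context (R : realType) (d : measure_display) (T : measurableType d)
  (P : probability T R) (X : {RV P >-> R}) (G : set (set T)).
Hypotheses (Gm : G `<=` measurable) (GI : setI_closed G) (GT : G setT).
Hypothesis GX : forall C A, G C -> measurable A ->
  P (C `&` X @^-1` A) = (P C * distribution P X A)%E.

Let S := g_sigma_algebraType G.

Let sGm (C : set T) : (<<s G >>) C -> measurable C.
Proof. exact: (smallest_sub (@sigma_algebra_measurable _ T) Gm). Qed.

Lemma measurable_fun_g_sigma d' (T' : measurableType d') (f : T -> T') :
  measurable_fun [set: S] (f : S -> T') -> measurable_fun [set: T] f.
Proof.
move=> mf _ A mA; rewrite setTI; apply: sGm.
by have := mf measurableT A mA; rewrite setTI.
Qed.

(** Both sides are finite measures in [C] that agree on the pi-system [G], hence on the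
    sigma-algebra it generates. *)
Let indep_sigma (C : set T) (A : set R) : (<<s G >>) C -> measurable A ->
  P (C `&` X @^-1` A) = (P C * distribution P X A)%E.
Proof.
move=> sC mA.
have mXA : measurable (X @^-1` A) by exact: measurable_funPTI.
have pfin : distribution P X A \is a fin_num by exact: fin_num_measure.
have r0 : 0 <= fine (distribution P X A) by exact: fine_ge0.
pose m1 := mrestr P mXA; pose m2 := mscale (NngNum r0) P.
suff : m1 C = m2 C by rewrite /m1 /m2 /mrestr /mscale/= fineK// muleC.
apply: (g_sigma_algebra_measure_unique G Gm (fun=> setT)) => //.
- by rewrite bigcup_const.
- move=> B GB; rewrite [LHS]GX// muleC -[in LHS](fineK pfin).
  by [].
- move=> _; rewrite /= /mrestr setTI.
  by rewrite (le_lt_trans (probability_le1 P mXA))// ltry.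
Qed.

(** Freezing lemma: the identity, seen as a random element of [S], that is [T] with the coarser
    sigma-algebra, is independent of [X]. The joint law is therefore a product, and Tonelli
    applies. *)
Lemma integral_independent (F : S * R -> \bar R) :
  measurable_fun setT F -> (forall z, (0 <= F z)%E) ->
  (\int[P]_w F (w, X w) = \int[P]_w \int[distribution P X]_x F (w, x))%E.
Proof.
move=> mF F0.
have mid : measurable_fun [set: T] (fun w : T => w : S).
  by move=> _ A mA; rewrite setTI; exact: sGm.
pose mid_ := isMeasurableFun.Build _ _ _ _ _ mid.
pose I : {RV P >-> S} := HB.pack (fun w : T => w : S) mid_.
have mIX : measurable_fun [set: T] (fun w : T => (w : S, X w)).
  by apply/measurable_fun_pairP; split => //=; exact: measurable_funPT.
pose mIX_ := isMeasurableFun.Build _ _ _ _ _ mIX.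
pose IX : {RV P >-> (S * R)%type} := HB.pack (fun w : T => (w : S, X w)) mIX_.
transitivity (\int[distribution P IX]_z F z)%E.
  by rewrite ge0_integral_distribution.
transitivity (\int[distribution P I \x distribution P X]_z F z)%E.
  apply: eq_measure_integral => A mA _; apply/esym.
  apply: product_measure_unique => //=.
rewrite fubini_tonelli1// ge0_integral_distribution//.
- exact: measurable_fun_fubini_tonelli_F.
- by move=> y; apply: integral_ge0.
Qed.

Lemma integral_independent_le (phi : S -> R) (psi : S * R -> R) (c : R) :
  measurable_fun setT phi -> (forall w, 0 <= phi w) ->
  measurable_fun setT psi -> (forall z, 0 <= psi z) -> 0 <= c ->
  (forall w, (\int[distribution P X]_x (psi (w, x))%:E <= c%:E)%E) ->
  (\int[P]_w (phi w * psi (w, X w))%:E <= c%:E * \int[P]_w (phi w)%:E)%E.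
Proof.
move=> mphi phi0 mpsi psi0 c0 hc.
pose F (z : S * R) := (phi z.1 * psi z)%:E.
have mF : measurable_fun setT F.
  apply/measurable_EFinP; apply: measurable_funM => //.
  by apply: measurableT_comp => //; exact: measurable_fst.
have F0 z : (0 <= F z)%E by rewrite lee_fin mulr_ge0.
have mphiT := measurable_fun_g_sigma mphi.
rewrite -ge0_integralZl//; last 2 first.
- exact/measurable_EFinP.
- by move=> w _; rewrite lee_fin.
rewrite (integral_independent mF F0); apply: ge0_le_integral => //.
- by move=> w _; exact: integral_ge0.
- have mFF : measurable_fun setT (fubini_F (distribution P X) F).
    exact: measurable_fun_fubini_tonelli_F.
  exact: (measurable_fun_g_sigma mFF).
- by apply: measurable_funeM; exact/measurable_EFinP.
move=> w _; rewrite /F/=; under eq_integral do rewrite EFinM.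
rewrite ge0_integralZl//.
- by rewrite muleC; apply: lee_wpmul2r => //; rewrite lee_fin.
- by apply/measurable_EFinP; exact: (measurableT_comp mpsi (pair1_measurable (w : S))).
- by move=> x _; rewrite lee_fin.
- by rewrite lee_fin.
Qed.

End independent_of_pi_system.

(** * Third differences along a Gaussian walk *)

(* [lebesgue_measure] and [normal_prob] live on [measurableTypeR R], whose
   display differs from the one of the canonical structure on [R]. *)
Lemma ge0_integral_measurableTypeR (R : realType)
    (mu : {measure set (measurableTypeR R) -> \bar R})
    (nu : {measure set R -> \bar R}) (f : R -> \bar R) :
  (forall A : set R, measurable A -> nu A = mu A) ->
  measurable_fun [set: R] f -> (forall x, (0 <= f x)%E) ->
  (\int[nu]_x f x = \int[mu]_x f x)%E.
Proof.
move=> numu mf f0; pose i : measurableTypeR R -> R := idfun.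
have mi : measurable_fun setT i by move=> _ A mA; rewrite setTI.
transitivity (\int[pushforward mu i]_x f x)%E.
  by apply: eq_measure_integral => A mA _; exact: numu.
by rewrite ge0_integral_pushforward.
Qed.

(** Up to sign, the third difference of the squares over the [k]-th block of four points; it
    annihilates polynomials of degree at most 2 in the index. *)
Definition third_diff_sqr (R : realType) (b : nat -> R) (k : nat) : R :=
  b (4 * k)%N ^+ 2 - 3 * b (4 * k).+1 ^+ 2 + 3 * b (4 * k).+2 ^+ 2
    - b (4 * k).+3 ^+ 2.

Lemma measurable_third_diff_sqr (R : realType) (d : measure_display)
    (T : measurableType d) (f : T -> nat -> R) (k : nat) :
  (forall i, (i <= (4 * k).+3)%N -> measurable_fun [set: T] (f^~ i)) ->
  measurable_fun [set: T] (fun w => third_diff_sqr (f w) k).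
Proof.
move=> mf; rewrite /third_diff_sqr.
apply: measurable_funB; last by apply: measurable_funX; exact: mf.
apply: measurable_funD; last first.
  by apply: measurable_funM => //; apply: measurable_funX; apply: mf; lia.
apply: measurable_funB; first by apply: measurable_funX; apply: mf; lia.
by apply: measurable_funM => //; apply: measurable_funX; apply: mf; lia.
Qed.

(** * Independence of an increment from its past *)

Section independent_sequence.
Context (R : realType) (d : measure_display) (T : measurableType d)
  (P : probability T R) (X : nat -> {RV P >-> R}) (N : nat).
Hypothesis indep : mutually_independent P (fun i : 'I_N => X i).

(* A pi-system generating the sigma-algebra of [X 0, ..., X m.-1]. *)
Definition past_events (m : nat) : set (set T) :=
  [set C | exists2 A : nat -> set R, (forall j, measurable (A j)) &
     C = \bigcap_(j in [set j | (j < m)%N]) (X j @^-1` A j)].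

Lemma past_events_measurable m : past_events m `<=` measurable.
Proof.
move=> _ [A mA ->]; apply: bigcap_measurableType => j _.
exact: measurable_funPTI.
Qed.

Lemma past_events_setI m : setI_closed (past_events m).
Proof.
move=> _ _ [A mA ->] [A' mA' ->]; exists (fun j => A j `&` A' j).
  by move=> j; exact: measurableI.
by rewrite -bigcapI.
Qed.

Lemma past_events_setT m : past_events m setT.
Proof. by exists (fun=> setT) => //; rewrite bigcapT. Qed.

(** Both events become rectangles over all [N] indices once padded with [setT]: [F0] leaves index
    [m] free, [F1] puts [A] there, and the two products differ in that factor only. *)
Lemma past_events_independent m C A : (m < N)%N -> past_events m C ->
  measurable A ->
  P (C `&` X m @^-1` A) = (P C * distribution P (X m) A)%E.
Proof.
move=> mN [F mF ->{C}] mA.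
pose F0 i := if (i < m)%N then F i else setT.
pose F1 i := if (i == m)%N then A else F0 i.
have mF0 i : measurable (F0 i) by rewrite /F0; case: ifP.
have mF1 i : measurable (F1 i) by rewrite /F1; case: ifP.
have E0 : \bigcap_(j in [set j | (j < m)%N]) (X j @^-1` F j) =
    \bigcap_(i : 'I_N) (X i @^-1` F0 i).
  apply/seteqP; split => w /= h i.
    by move=> _; rewrite /F0; case: ifP => // im; exact: h.
  move=> im; have /= := h (Ordinal (ltn_trans im mN)) I.
  by rewrite /F0 im.
have E1 : \bigcap_(j in [set j | (j < m)%N]) (X j @^-1` F j) `&` X m @^-1` A =
    \bigcap_(i : 'I_N) (X i @^-1` F1 i).
  rewrite E0; apply/seteqP; split => w /=.
    move=> [h hA] i _; rewrite /F1; case: ifPn => [/eqP ->//|_]; exact: h.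
  move=> h; split => [i _|].
    have /= := h i I; rewrite /F1; case: ifPn => // /eqP im _.
    by rewrite /F0 im ltnn.
  by have /= := h (Ordinal mN) I; rewrite /F1 eqxx.
rewrite E1 E0 (indep (fun i => mF1 i)) (indep (fun i => mF0 i)).
rewrite (bigD1 (Ordinal mN))//= [in RHS](bigD1 (Ordinal mN))//=.
have -> : F1 m = A by rewrite /F1 eqxx.
have -> : F0 m = setT by rewrite /F0 ltnn.
rewrite preimage_setT probability_setT mul1e muleC.
congr (_ * _)%E; apply: eq_bigr => i im; rewrite /F1 ifN//.
Qed.

Lemma measurable_fun_past m j : (j < m)%N ->
  measurable_fun [set: g_sigma_algebraType (past_events m)]
    (X j : g_sigma_algebraType (past_events m) -> R).
Proof.
move=> jm _ A mA; rewrite setTI; apply: sub_sigma_algebra.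
exists (fun i => if i == j then A else setT); first by move=> i; case: ifP.
apply/seteqP; split => w /= h; last by have /= := h j jm; rewrite eqxx.
by move=> i /= _; case: ifPn => // /eqP ->.
Qed.

End independent_sequence.

(** * Laplace transform over disjoint blocks of a Gaussian walk *)

Section gaussian_walk.
Context (R : realType) (d : measure_display) (T : measurableType d)
  (P : probability T R) (X : nat -> {RV P >-> R}) (n : nat) (s tau : R).
Hypotheses (s0 : 0 < s) (tau0 : 0 <= tau) (htau : 3 <= tau * (s / 16) ^+ 4).
Hypothesis indep : mutually_independent P (fun i : 'I_(4 * n) => X i).
(** Index 0 is excluded because the first increment leads from time 0 to the first grid point, over
    a length that differs from the mesh. *)
Hypothesis gauss : forall i, (0 < i < 4 * n)%N -> forall A : set R,
  measurable A -> distribution P (X i) A = normal_prob 0 s A.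

Let W i w : R := \sum_(j < i.+1) X j w.

Let measurable_walk m i : (i < m)%N ->
  measurable_fun [set: g_sigma_algebraType (past_events X m)]
    (W i : g_sigma_algebraType (past_events X m) -> R).
Proof.
move=> im; apply: measurable_sum => j.
by apply: measurable_fun_past; exact: leq_trans (ltn_ord j) im.
Qed.

(** Induction on the number of blocks: with everything before the last increment of the new block
    frozen, the quartic Gaussian bound contributes a factor [1 / 2]. *)
Lemma expectation_expR_third_diff_le m : (m <= n)%N ->
  (\int[P]_w (expR (- (tau * \sum_(k < m) third_diff_sqr (W^~ w) k ^+ 2)))%:E
    <= (2^-1 ^+ m)%:E)%E.
Proof.
elim: m => [_|m IH mn].
  under eq_integral do rewrite big_ord0 mulr0 oppr0 expR0.
  rewrite integral_cst//=.
  by rewrite probability_setT mule1 expr0.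
(* [X M] is the last increment of block [m]. In the first [m + 1] blocks it enters only through the
   final point [W M]; all the rest is a function of the past of [M]. *)
set M := (4 * m).+3.
have MN : (M < 4 * n)%N by rewrite /M; lia.
set S := g_sigma_algebraType (past_events X M).
have mW i : (i < M)%N -> measurable_fun [set: S] (W i : S -> R).
  exact: measurable_walk.
pose phi (w : S) : R :=
  expR (- (tau * \sum_(k < m) third_diff_sqr (W^~ w) k ^+ 2)).
pose a (w : S) : R := W (4 * m)%N w ^+ 2 - 3 * W (4 * m).+1 w ^+ 2
   + 3 * W (4 * m).+2 w ^+ 2.
pose psi (z : S * R) : R :=
  expR (- (tau * (a z.1 - (W (4 * m).+2 z.1 + z.2) ^+ 2) ^+ 2)).
have mphi : measurable_fun [set: S] phi.
  apply: measurableT_comp => //; apply: measurableT_comp => //.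
  apply: measurable_funM => //; apply: measurable_sum => k.
  apply: measurable_funX; apply: measurable_third_diff_sqr => i ik; apply: mW.
  by have := ltn_ord k; rewrite /M; lia.
have ma : measurable_fun [set: S] a.
  apply: measurable_funD; last first.
    by apply: measurable_funM => //; apply: measurable_funX; apply: mW; rewrite /M; lia.
  apply: measurable_funB.
    by apply: measurable_funX; apply: mW; rewrite /M; lia.
  apply: measurable_funM => //; apply: measurable_funX; apply: mW; rewrite /M; lia.
have mpsi : measurable_fun [set: S * R] psi.
  apply: measurableT_comp => //; apply: measurableT_comp => //.
  apply: measurable_funM => //; apply: measurable_funX.
  apply: measurable_funB.
    exact: measurableT_comp ma measurable_fst.
  apply: measurable_funX; apply: measurable_funD.
    exact: measurableT_comp (mW _ (ltnSn _)) measurable_fst.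
  exact: measurable_snd.
have hpsi w : (\int[distribution P (X M)]_x (psi (w, x))%:E <= (2^-1)%:E)%E.
  have -> : (\int[distribution P (X M)]_x (psi (w, x))%:E =
      \int[normal_prob 0 s]_x (psi (w, x))%:E)%E.
    apply: ge0_integral_measurableTypeR.
    - by move=> A; apply: gauss; rewrite MN.
    - by apply/measurable_EFinP; exact: (measurableT_comp mpsi (pair1_measurable (w : S))).
    - by move=> x; rewrite lee_fin expR_ge0.
  exact: (@integral_normal_expR_quartic_le R (a w) (W (4 * m).+2 w) s tau).
have half0 : 0 <= 2^-1 :> R by rewrite invr_ge0.
have key := integral_independent_le (@past_events_measurable _ _ _ _ X M)
  (@past_events_setI _ _ _ _ X M) (@past_events_setT _ _ _ _ X M)
  (fun C A => @past_events_independent _ _ _ _ X _ indep M C A MN) mphi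
  (fun w => expR_ge0 _) mpsi (fun w => expR_ge0 _) half0 hpsi.
have -> : (\int[P]_w
    (expR (- (tau * \sum_(k < m.+1) third_diff_sqr (W^~ w) k ^+ 2)))%:E =
    \int[P]_w (phi w * psi (w, X M w))%:E)%E.
  apply: eq_integral => w _; rewrite /phi /psi/= -expRD big_ord_recr/=.
  congr (expR _)%:E; rewrite /third_diff_sqr -/M -/(a w).
  have -> : W M w = W (4 * m).+2 w + X M w by rewrite /W big_ord_recr.
  by rewrite mulrDr opprD.
rewrite (le_trans key)// exprS EFinM lee_wpmul2l ?lee_fin//.
exact: (IH (ltnW mn)).
Qed.

End gaussian_walk.

(** * Averages over shifted grids and joint measurability *)

Section lebesgue_shift.
Context (R : realType).
Local Notation mu := (@lebesgue_measure R).
Local Notation mR := (measurableTypeR R).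

Let measurable_shift (c : R) : measurable_fun setT (fun x : mR => x + c : mR).
Proof. exact: measurable_funD. Qed.

Lemma ge0_integral_shift (f : mR -> \bar R) (a b c : R) :
  measurable_fun setT f -> (forall x, (0 <= f x)%E) ->
  (\int[mu]_(x in `[(a + c)%R, (b + c)%R[) f x =
   \int[mu]_(x in `[a, b[) f (x + c)%R)%E.
Proof.
move=> mf f0; pose t : mR -> mR := fun x => x + c.
have mt : measurable_fun setT t by exact: measurable_shift.
have pre x y b0 b1 : t @^-1` [set` Interval (BSide b0 (x + c)) (BSide b1 (y + c))] =
    [set` Interval (BSide b0 x) (BSide b1 y)].
  apply/seteqP; split => z /=; rewrite !in_itv/=;
  case: b0; case: b1; rewrite /t /= ?lerD2r ?ltrD2r //.
have pushE (A : set mR) : measurable A -> mu A = pushforward mu t A.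
  apply: lebesgue_measure_unique => //= _ [[x y]] _ <-.
  have pre_xy : t @^-1` `]x, y] = `]x - c, y - c]%classic by rewrite -pre !subrK.
  rewrite /pushforward [X in _ = mu X]pre_xy.
  rewrite !lebesgue_measure_itv/= !lte_fin ltrD2r.
  by case: ifP => // _; rewrite -!EFinB; congr (_%:E); ring.
transitivity (\int[pushforward mu t]_(x in `[(a + c)%R, (b + c)%R[) f x)%E.
  by apply: eq_measure_integral => A mA _; exact: pushE.
rewrite ge0_integral_pushforward//; first by rewrite pre.
exact: measurable_funTS.
Qed.

(** Translating each of the [m] cells of length [h] onto the first one turns the integral into an
    average, over the offset [u], of sums along a shifted grid. *)
Lemma ge0_integral_itv_average (f : mR -> \bar R) (a h : R) (ah : a < a + h)
    (m : nat) :
  measurable_fun setT f -> (forall x, (0 <= f x)%E) ->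
  (\int[mu]_(x in `[a, (a + m%:R * h)%R[) f x =
   h%:E * \int[uniform_prob ah]_u \sum_(i < m) f (u + i%:R * h)%R)%E.
Proof.
move=> mf f0.
have h0 : 0 < h by move: ah; rewrite ltrDl.
have mfi i : measurable_fun setT (fun u : mR => f (u + i%:R * h)%R).
  by apply: measurableT_comp => //; exact: measurable_shift.
have msum k : measurable_fun setT (fun u : mR => (\sum_(i < k) f (u + i%:R * h)%R)%E).
  by apply: emeasurable_sum => i; exact: mfi.
rewrite integral_uniform//; last by move=> x; exact: sume_ge0.
rewrite (addrC a h) addrK muleA -EFinM mulfV ?gt_eqF// mul1e (addrC h a).
rewrite -integral_itv_bndo_bndc; last by apply: measurable_funTS; exact: msum.
elim: m => [|m IH].
  rewrite mul0r addr0 set_itv_ge ?bnd_simp ?ltxx// integral_set0.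
  by under eq_integral do rewrite big_ord0; rewrite integral0.
under [RHS]eq_integral do rewrite big_ord_recr/=.
rewrite ge0_integralD//=; last 3 first.
- by move=> x _; exact: sume_ge0.
- by apply: measurable_funTS; exact: msum.
- by apply: measurable_funTS; exact: mfi.
rewrite -IH -(ge0_integral_shift _ _ (m%:R * h))//.
have am : a <= a + m%:R * h by rewrite lerDl mulr_ge0// ltW.
have amh : a + m%:R * h <= a + h + m%:R * h by rewrite lerD2r ltW.
have E : a + m.+1%:R * h = a + h + m%:R * h by rewrite -natr1; ring.
have -> : `[a, a + m.+1%:R * h[%classic =
    `[a, a + m%:R * h[%classic `|` `[a + m%:R * h, a + h + m%:R * h[%classic.
  by rewrite E -itv_bndbnd_setU// bnd_simp.
rewrite ge0_integral_setU//.
- exact: measurable_funTS.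
- apply/disj_set2P/seteqP; split => // x [] /=; rewrite !in_itv/=.
  by move=> /andP[_ x1] /andP[x2 _]; move: (lt_le_trans x1 x2); rewrite ltxx.
Qed.

End lebesgue_shift.

Section joint_measurability.
Context (R : realType) (d : measure_display) (T : measurableType d).
Local Notation mR := (measurableTypeR R).
Variable B : R -> {mfun T >-> R}.
Hypothesis cB : forall w : T, {within `[0, 1], continuous (fun t : R => B t w)}.

(* Only the paths on [[0, 1]] are constrained; precomposing with [clamp01] makes
   them continuous on the whole line. *)
Definition clamp01 (l : R) : R := Num.max 0 (Num.min 1 l).

Lemma clamp01_id l : 0 <= l <= 1 -> clamp01 l = l.
Proof.
by move=> /andP[l0 l1]; rewrite /clamp01 min_r// max_r.
Qed.

Lemma clamp01_itv l : 0 <= clamp01 l <= 1.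
Proof. by rewrite /clamp01 le_max lexx/= ge_max ler01/= ge_min lexx. Qed.

Lemma measurable_clamp01 : measurable_fun [set: mR] (clamp01 : mR -> mR).
Proof.
apply: measurable_maxr; first exact: measurable_cst.
by apply: measurable_minr; [exact: measurable_cst|exact: measurable_id].
Qed.

Let grid (n : nat) (l : R) : nat := Num.truncn (n.+1%:R * clamp01 l).

Let measurable_grid n k : measurable ([set l | grid n l = k] : set mR).
Proof.
have -> : [set l | grid n l = k] = (fun l : mR => n.+1%:R * clamp01 l : mR) @^-1`
    `[k%:R, k.+1%:R[.
  have g0 l : 0 <= n.+1%:R * clamp01 l.
    by rewrite mulr_ge0//; have /andP[] := clamp01_itv l.
  apply/seteqP; split => l /=; rewrite in_itv/=.
    by move=> <-; exact: truncn_itv.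
  by move=> lk; apply/truncn_def.
rewrite -[X in measurable X]setTI; apply: (measurable_funM _ measurable_clamp01) => //.
Qed.

(** The process is the pointwise limit of its discretizations in time, by continuity of the paths.
    Preimages under a discretization are countable unions of rectangles. *)
Lemma measurable_continuous_process :
  measurable_fun [set: mR * T] (fun z : mR * T => B (clamp01 z.1) z.2).
Proof.
pose b n (z : mR * T) := B ((grid n z.1)%:R / n.+1%:R) z.2.
apply: (measurable_fun_cvg (h := b)).
  move=> n _ Y mY; rewrite setTI.
  have -> : b n @^-1` Y = \bigcup_k ([set l | grid n l = k] `*`
      (B (k%:R / n.+1%:R) @^-1` Y)).
    apply/seteqP; split => [[l w] /= bY|[l w] /= [k _ [/= <-]]//].
    by exists (grid n l).
  apply: bigcupT_measurable => k; apply: measurableX => //.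
  exact: measurable_funPTI.
move=> [l w] _; rewrite /b/=; set x := clamp01 l.
have /andP[x0 x1] := clamp01_itv l; rewrite -/x in x0 x1.
have gridb n : x - n.+1%:R^-1 <= (grid n l)%:R / n.+1%:R <= x.
  have /truncn_itv/andP[g1 g2] : 0 <= n.+1%:R * clamp01 l by rewrite mulr_ge0.
  rewrite -/(grid n l) -/x in g1 g2; apply/andP; split.
    by rewrite ler_pdivlMr// mulrBl mulVf// lerBlDr natr1 mulrC ltW.
  by rewrite ler_pdivrMr// mulrC.
have cx : (grid n l)%:R / n.+1%:R @[n --> \oo] --> x.
  apply: (squeeze_cvgr (f := fun n => x - n.+1%:R^-1) (h := fun=> x)).
  - by near=> n; exact: gridb.
  - rewrite -[X in _ --> X]subr0; apply: cvgB; first exact: cvg_cst.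
    exact: cvg_harmonic.
  - exact: cvg_cst.
have cBx : (fun t => B t w) @ within `[0, 1]%classic (nbhs x) --> B x w.
  by move/subspace_continuousP: (@cB w); apply; rewrite /= in_itv/= x0 x1.
apply: (cvg_comp _ _ _ cBx).
move=> A; rewrite /within/= => wA.
have wA' : \forall n \near \oo,
    `[0, 1]%classic ((grid n l)%:R / n.+1%:R : R) -> A ((grid n l)%:R / n.+1%:R).
  exact: cx _ wA.
apply: (filterS _ wA') => n /=; apply.
rewrite in_itv/= divr_ge0//=; have /andP[_ gx] := gridb n.
exact: le_trans x1.
Unshelve. all: by end_near. Qed.

End joint_measurability.

(* Jensen's inequality, by integrating the tangent line of [x |-> expR (- x)]. *)
Lemma expR_mean_le (R : realType) (d : measure_display) (T : measurableType d)
    (mu : probability T R) (Y : T -> R) :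
  measurable_fun setT Y -> (forall x, 0 <= Y x) ->
  (\int[mu]_x (Y x)%:E < +oo)%E ->
  ((expR (- fine (\int[mu]_x (Y x)%:E)))%:E <=
   \int[mu]_x (expR (- Y x))%:E)%E.
Proof.
move=> mY Y0 Yfin.
have Yge0 : (0 <= \int[mu]_x (Y x)%:E)%E.
  by apply: integral_ge0 => x _; rewrite lee_fin.
have Yf : (\int[mu]_x (Y x)%:E)%E \is a fin_num by rewrite ge0_fin_numE.
set m := fine _; set c := expR (- m).
have c0 : 0 <= c by exact: expR_ge0.
have mexp : measurable_fun setT (fun x => (expR (- Y x))%:E).
  by apply/measurable_EFinP; apply: measurableT_comp => //; exact: measurableT_comp.
have mcY : measurable_fun setT (fun x => (c * Y x)%:E).
  by apply/measurable_EFinP; exact: measurable_funM.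
rewrite -(@leeD2rE _ (c * m)%:E)//.
have cmE : (\int[mu]_x (c * Y x)%:E = (c * m)%:E)%E.
  under eq_integral do rewrite EFinM.
  rewrite ge0_integralZl//; last 2 first.
  - exact/measurable_EFinP.
  - by move=> x _; rewrite lee_fin.
  by rewrite EFinM fineK.
rewrite -{2}cmE.
rewrite -ge0_integralD//; last first.
  by move=> x _; rewrite lee_fin mulr_ge0.
apply: (@le_trans _ _ (\int[mu]_x (cst (c + c * m)%:E x))%E).
  by rewrite integral_cst//= probability_setT mule1.
apply: ge0_le_integral => //=.
- by move=> x _; rewrite lee_fin addr_ge0// mulr_ge0// fine_ge0.
- by apply: emeasurable_funD.
move=> x _; rewrite -EFinD lee_fin.
have : c * (1 + (m - Y x)) <= expR (- Y x).
  have -> : expR (- Y x) = c * expR (m - Y x).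
    by rewrite /c -expRD; congr expR; ring.
  by rewrite ler_wpM2l// expR_ge1Dx.
move=> h; rewrite -lerBlDr; apply: le_trans h.
by rewrite le_eqVlt; apply/predU1P; left; ring.
Qed.

(** The drift terms are polynomials of degree 1 and 2 in [i], so [f] and the squares of [b] have the
    same third differences. Cauchy-Schwarz on each block then gives the constant
    [1 + 9 + 9 + 1 = 20]. *)
Lemma third_diff_sqr_le (R : realType) (f b : nat -> R) (u h c : R) (n : nat) :
  (forall i, (i < 4 * n)%N ->
    f i = b i ^+ 2 - (u + i%:R * h) - (u + i%:R * h) ^+ 2 * c) ->
  \sum_(k < n) third_diff_sqr b k ^+ 2 <= 20 * \sum_(i < 4 * n) f i ^+ 2.
Proof.
elim: n => [|n IH] fE; first by rewrite muln0 !big_ord0 mulr0.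
have fE' i : (i < 4 * n)%N ->
    f i = b i ^+ 2 - (u + i%:R * h) - (u + i%:R * h) ^+ 2 * c.
  by move=> ilt; apply: fE; rewrite (leq_trans ilt)// leq_mul2l leqnSn orbT.
have {}IH := IH fE'.
have -> : (4 * n.+1 = (4 * n).+4)%N by rewrite mulnS addnC addn4.
rewrite big_ord_recr/= !(big_ord_recr (_.+1)) (big_ord_recr (4 * n)%N)/=.
set N := (4 * n)%N in fE *.
have -> : third_diff_sqr b n = f N - 3 * f N.+1 + 3 * f N.+2 - f N.+3.
  rewrite /third_diff_sqr -/N !fE ?/N; try lia.
  by rewrite -!natr1; ring.
move: IH; set S1 := \sum_(k < n) _; set S2 := \sum_(i < _) _ => IH.
move: (f N) (f N.+1) (f N.+2) (f N.+3) => p q r s.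
have : (p - 3 * q + 3 * r - s) ^+ 2 <= 20 * (p ^+ 2 + q ^+ 2 + r ^+ 2 + s ^+ 2).
  rewrite -subr_ge0.
  (* Lagrange's identity: the defect in Cauchy-Schwarz is the sum of the squares of the six 2 by 2
     minors. *)
  have -> : 20 * (p ^+ 2 + q ^+ 2 + r ^+ 2 + s ^+ 2) - (p - 3 * q + 3 * r - s) ^+ 2
    = (q + 3 * p) ^+ 2 + (r - 3 * p) ^+ 2 + (s + p) ^+ 2 + (3 * r + 3 * q) ^+ 2
      + (3 * s - q) ^+ 2 + (3 * s + r) ^+ 2 by ring.
  by rewrite !addr_ge0// sqr_ge0.
lra.
Qed.

(** * The weighted deviation *)

Section weighted_deviation.
Context (R : realType) (d : measure_display) (T : measurableType d).
Local Notation mR := (measurableTypeR R).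
Variables (B : R -> {mfun T >-> R}) (alpha : R).
Hypothesis cB : forall w : T, {within `[0, 1], continuous (fun t : R => B t w)}.
Hypothesis alpha0 : 0 <= alpha.

Definition deviation (l : R) (w : T) : R := procM B l w - l ^+ 2 * procM B 1 w.

Let wdev (z : mR * T) : R :=
  clamp01 z.1 `^ alpha * deviation (clamp01 z.1) z.2 ^+ 2.

Lemma measurable_deviation :
  measurable_fun [set: mR * T]
    (fun z : mR * T => deviation (clamp01 z.1) z.2).
Proof.
have m1 : measurable_fun [set: mR * T] (fun z : mR * T => clamp01 z.1 : R).
  exact: (measurableT_comp (@measurable_clamp01 R) measurable_fst).
have mB1 : measurable_fun [set: mR * T] (fun z : mR * T => B 1 z.2).
  by apply: measurableT_comp => //; exact: measurable_snd.
rewrite /deviation /procM; apply: measurable_funB.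
  apply: measurable_funB => //; apply: measurable_funX.
  exact: measurable_continuous_process.
apply: measurable_funM; first exact: measurable_funX.
by apply: measurable_funB => //; exact: measurable_funX.
Qed.

Let measurable_wdev : measurable_fun [set: mR * T] wdev.
Proof.
apply: measurable_funM; last by apply: measurable_funX; exact: measurable_deviation.
have m1 : measurable_fun [set: mR * T] (fun z : mR * T => clamp01 z.1 : R).
  exact: (measurableT_comp (@measurable_clamp01 R) measurable_fst).
exact: (measurableT_comp (@measurable_powR R alpha) m1).
Qed.

Let wdev_ge0 z : 0 <= wdev z.
Proof. by rewrite mulr_ge0 ?powR_ge0 ?sqr_ge0. Qed.

Let meas_wdev_l (w : T) : measurable_fun [set: mR] (fun l : mR => (wdev (l, w))%:E).
Proof.
apply/measurable_EFinP; exact: (measurableT_comp measurable_wdev (pair2_measurable w)).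
Qed.

Lemma rvW_sqrE w :
  rvW B alpha w ^+ 2 = fine (\int[uniform_prob (@ltr01 R)]_l (wdev (l, w))%:E)%E.
Proof.
rewrite /rvW sqr_sqrtr; last first.
  by apply: Rintegral_ge0 => l _; rewrite mulr_ge0 ?powR_ge0 ?sqr_ge0.
rewrite integral_uniform//; last by move=> l; rewrite lee_fin.
rewrite subr0 invr1 mul1e /Rintegral; congr fine.
apply: eq_integral => l; rewrite inE/= in_itv/= => l01.
by rewrite /wdev/= clamp01_id.
Qed.

Lemma measurable_rvW : measurable_fun [set: T] (rvW B alpha).
Proof.
have -> : rvW B alpha = Num.sqrt \o (fun w =>
    fine (\int[uniform_prob (@ltr01 R)]_l (wdev (l, w))%:E)%E).
  by apply/funext => w /=; rewrite -rvW_sqrE sqrtr_sqr ger0_norm// sqrtr_ge0.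
apply: measurableT_comp; first exact: continuous_measurable_fun (@sqrt_continuous R).
apply: measurableT_comp => //.
have mE : measurable_fun setT (EFin \o wdev) by exact/measurable_EFinP.
have mG : measurable_fun setT (fubini_G (uniform_prob (@ltr01 R)) (EFin \o wdev)).
  by apply: measurable_fun_fubini_tonelli_G => // z; rewrite lee_fin.
exact: mG.
Qed.

(** A continuous path is bounded on the unit interval. The resulting finiteness matters because
    [fine] sends an infinite integral to 0. *)
Let wdev_bounded w : exists K : R, forall l : mR, wdev (l, w) <= K.
Proof.
have [a _ ha] := EVT_max (@ler01 R) (@cB w).
have [b _ hb] := EVT_min (@ler01 R) (@cB w).
pose K := `|B a w| + `|B b w|.
have BK l : 0 <= l <= 1 -> B l w ^+ 2 <= K ^+ 2.
  move=> l01; rewrite -[leLHS]real_normK ?num_real// lerXn2r// ?nnegrE//.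
    by rewrite addr_ge0.
  rewrite ler_norml; apply/andP; split.
    have := hb l; rewrite in_itv/= l01 => /(_ isT); apply: le_trans.
    rewrite /K opprD; have := ler_norm (- B b w); rewrite normrN.
    by have := normr_ge0 (B a w); lra.
  have := ha l; rewrite in_itv/= l01 => /(_ isT) /le_trans; apply.
  by rewrite /K; have := ler_norm (B a w); have := normr_ge0 (B b w); lra.
exists ((2 * K ^+ 2 + 2) ^+ 2) => l; rewrite /wdev/=.
have l01 := clamp01_itv l; move: l01; set x := clamp01 l => x01.
have /andP[x0 x1] := x01.
rewrite -[leRHS]mul1r ler_pM ?powR_ge0 ?sqr_ge0//.
  by apply: (@le_trans _ _ (1 `^ alpha)); [rewrite ge0_ler_powR// nnegrE|rewrite powR1].
have B1 : B 1 w ^+ 2 <= K ^+ 2 by apply: BK; rewrite ler01 lexx.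
have := BK _ x01; have := sqr_ge0 (B x w); have := sqr_ge0 (B 1 w).
move=> b1 bx bxK; rewrite -[leLHS]real_normK ?num_real//.
rewrite lerXn2r ?nnegrE//; first by have := sqr_ge0 K; lra.
rewrite /deviation /procM ler_norml; apply/andP.
have x2 : 0 <= x ^+ 2 <= 1 by rewrite sqr_ge0 expr_le1.
move: (x ^+ 2) x2 (B x w ^+ 2) (B 1 w ^+ 2) (K ^+ 2) B1 b1 bx bxK.
move=> y /andP[y0 y1] p q k qk q0 p0 pk.
have yq0 : 0 <= y * q by rewrite mulr_ge0.
have yq1 : y * q <= q by rewrite ler_piMl.
by rewrite mulrBr; split; lra.
Qed.

Let integral_wdev_lty w :
  (\int[uniform_prob (@ltr01 R)]_l (wdev (l, w))%:E < +oo)%E.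
Proof.
have [K hK] := wdev_bounded w.
have K0 : 0 <= K := le_trans (wdev_ge0 (0, w)) (hK 0).
apply: (@le_lt_trans _ _ (\int[uniform_prob (@ltr01 R)]_l (cst K%:E l))%E).
  by apply: ge0_le_integral => //= l _; rewrite lee_fin// wdev_ge0.
rewrite integral_cst//= (_ : uniform_prob _ _ = 1%E) ?mule1 ?ltry//.
exact: (@probability_setT _ _ _ (uniform_prob (@ltr01 R))).
Qed.

Lemma rvW_sqr_ge (n : nat) (h : R) (hh : 2^-1 < 2^-1 + h) w :
  (4 * n)%:R * h = 2^-1 ->
  ((2^-1 `^ alpha * h)%:E * \int[uniform_prob hh]_u
      (\sum_(i < 4 * n) deviation (clamp01 (u + i%:R * h)) w ^+ 2)%:E
    <= (rvW B alpha w ^+ 2)%:E)%E.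
Proof.
move=> nh.
pose F (l : mR) := (deviation (clamp01 l) w ^+ 2)%:E.
have F0 l : (0 <= F l)%E by rewrite lee_fin sqr_ge0.
have mF : measurable_fun setT F.
  apply/measurable_EFinP; apply: measurable_funX.
  exact: (measurableT_comp measurable_deviation (pair2_measurable w)).
rewrite rvW_sqrE fineK; last first.
  by rewrite ge0_fin_numE// integral_ge0// => l _; rewrite lee_fin.
under eq_integral do rewrite -sumEFin.
rewrite EFinM -muleA -(ge0_integral_itv_average hh _ mF F0).
rewrite integral_uniform//; last by move=> l; rewrite lee_fin.
rewrite subr0 invr1 mul1e nh.
have -> : 2^-1 + 2^-1 = 1 :> R by lra.
rewrite -ge0_integralZl//; last first.
  exact: measurable_funTS.
apply: (@le_trans _ _
    (\int[lebesgue_measure]_(l in `[(2^-1)%R, 1%R[) (wdev (l, w))%:E)%E).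
  apply: ge0_le_integral => //=.
  - by move=> l _; rewrite mule_ge0// lee_fin powR_ge0.
  - by apply: measurable_funeM; exact: measurable_funTS.
  - exact: measurable_funTS.
  move=> l; rewrite in_itv/= => /andP[l0 l1].
  rewrite /F -EFinM lee_fin /wdev/= ler_wpM2r ?sqr_ge0//.
  have l00 : 0 <= (l : R) by rewrite (le_trans _ l0).
  rewrite clamp01_id; last by rewrite l00 (ltW l1).
  by rewrite ge0_ler_powR// nnegrE.
apply: ge0_subset_integral => //=.
- exact: measurable_funTS.
- by move=> l _; rewrite lee_fin.
- move=> l /=; rewrite !in_itv/= => /andP[l0 l1].
  by rewrite (ltW l1) andbT (le_trans _ l0).
Qed.

End weighted_deviation.

(** * Laplace transform of the weighted deviation *)

Lemma le_integral_uniform (R : realType) (a b : R) (ab : a < b)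
    (f g : measurableTypeR R -> \bar R) :
  measurable_fun setT f -> measurable_fun setT g ->
  (forall x, (0 <= f x)%E) -> (forall x, (0 <= g x)%E) ->
  (forall x, a <= x <= b -> (f x <= g x)%E) ->
  (\int[uniform_prob ab]_x f x <= \int[uniform_prob ab]_x g x)%E.
Proof.
move=> mf mg f0 g0 fg; rewrite !integral_uniform//.
apply: lee_wpmul2l; first by rewrite lee_fin invr_ge0 subr_ge0 ltW.
apply: ge0_le_integral => //=.
- exact: measurable_funTS.
- exact: measurable_funTS.
Qed.

Section brownian.
Context (R : realType) (d : measure_display) (T : measurableType d)
  (P : probability T R) (B : R -> {RV P >-> R}).
Hypothesis hB : standard_brownian_motion01 P B.
Local Notation mR := (measurableTypeR R).

Let cB := brownian_continuous hB.

Let sampled (h : R) (n : nat) (z : mR * T) : R :=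
  \sum_(k < n) third_diff_sqr (fun i => B (clamp01 (z.1 + i%:R * h)) z.2) k ^+ 2.

Let measurable_sampled h n : measurable_fun [set: mR * T] (sampled h n).
Proof.
apply: measurable_sum => k; apply: measurable_funX.
apply: measurable_third_diff_sqr => i _.
have mshift : measurable_fun [set: mR * T]
    (fun z : mR * T => ((z.1 + i%:R * h : mR), z.2)).
  apply/measurable_fun_pairP; split => /=; last exact: measurable_snd.
  by apply: measurable_funD => //; exact: measurable_fst.
exact: (measurableT_comp (measurable_continuous_process cB) mshift).
Qed.

Let expectation_sampled_le (h tau u : R) (n : nat) :
  0 < h -> 0 < u -> u + (4 * n)%:R * h <= 1 + h -> (0 < n)%N ->
  0 <= tau -> 3 <= tau * (Num.sqrt h / 16) ^+ 4 ->
  (\int[P]_w (expR (- (tau * sampled h n (u, w))))%:E <= (2^-1 ^+ n)%:E)%E.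
Proof.
move=> h0 u0 uh n0 tau0 htau.
(* The grid is preceded by time 0, so that partial sums of the increments recover [B] on the grid.
   The last time is [tt (4 * n) = u + (4 * n - 1) * h], whence the bound [1 + h] in the
   hypothesis. *)
pose tt i : R := if i is i'.+1 then u + i'%:R * h else 0.
have tt_le i : (i <= 4 * n)%N -> tt i <= 1.
  case: i => [|i] iN; first exact: ler01.
  have : i.+1%:R * h <= (4 * n)%:R * h by rewrite ler_pM2r// ler_nat.
  by rewrite -natr1 mulrDl mul1r /=; lra.
have tt_lt i : tt i < tt i.+1.
  by case: i => [|i] /=; rewrite ?mul0r ?addr0// ltrD2l ltr_pM2r// ltr_nat.
have tt_ge0 i : 0 <= tt i.
  by case: i => [|i]//=; rewrite addr_ge0 ?(ltW u0)// mulr_ge0// ltW.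
pose X i : {RV P >-> R} := B (tt i.+1) \- B (tt i).
have indep : mutually_independent P (fun i : 'I_(4 * n) => X i).
  by apply: (brownian_independent hB) => //; exact: tt_le.
have gauss i : (0 < i < 4 * n)%N -> forall A : set R, measurable A ->
    distribution P (X i) A = normal_prob 0 (Num.sqrt h) A.
  move=> /andP[i0 iN] A mA.
  have -> : h = tt i.+1 - tt i.
    by case: i i0 iN => // i _ _ /=; rewrite -natr1; ring.
  exact: (brownian_increment hB (tt_ge0 i) (tt_lt i) (tt_le _ iN) mA).
have sh0 : 0 < Num.sqrt h by rewrite sqrtr_gt0.
have key := expectation_expR_third_diff_le sh0 tau0 htau indep gauss (leqnn n).
rewrite (le_trans _ key)// le_eqVlt; apply/predU1P; left.
have mexp (g : T -> R) : measurable_fun setT g ->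
    measurable_fun setT (fun w => (expR (- (tau * g w)))%:E).
  move=> mg; apply/measurable_EFinP; apply: measurableT_comp => //.
  by apply: measurableT_comp => //; exact: measurable_funM.
(* [B 0] vanishes only almost surely, so the walk and the sampled path agree off a null set. *)
apply: ge0_ae_eq_integral => //.
- apply: mexp; exact: (measurableT_comp (measurable_sampled h n) (pair1_measurable u)).
- apply: mexp; apply: measurable_sum => k; apply: measurable_funX.
  apply: measurable_third_diff_sqr => i _; apply: measurable_sum => j.
  exact: measurable_funPT.
have := brownian_start hB; apply: filterS => w Bw0 _.
congr (expR (- (tau * _)))%:E; apply: eq_bigr => k _; congr (_ ^+ 2).
have walkE i : (i < 4 * n)%N ->
    B (clamp01 (u + i%:R * h)) w = \sum_(j < i.+1) X j w.
  move=> iN; rewrite -(big_mkord xpredT (fun j => X j w)) /=.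
  rewrite (telescope_sumr (fun j => B (tt j) w))// Bw0 subr0 clamp01_id//.
  by rewrite -[u + _]/(tt i.+1) tt_ge0 tt_le.
by rewrite /third_diff_sqr !walkE//; have := ltn_ord k; lia.
Qed.

(* With [h = 1 / (8 n)], the hypothesis on [t] says that
   [tau = t * 2^-alpha * h / 20] satisfies [3 <= tau * (sqrt h / 16) ^ 4]. *)
Lemma expectation_expR_rvW_le (alpha t : R) (n : nat) : 0 <= alpha ->
  (0 < n)%N -> 60 * 16 ^+ 4 * 8 ^+ 3 / (2^-1 `^ alpha) * n%:R ^+ 3 <= t ->
  (\int[P]_w (expR (- (t * rvW B alpha w ^+ 2)))%:E <= (2^-1 ^+ n)%:E)%E.
Proof.
move=> alpha0 n0 tK.
set c := 2^-1 `^ alpha in tK; have c0 : 0 < c by rewrite powR_gt0// invr_gt0.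
have nR0 : 0 < n%:R :> R by rewrite ltr0n.
pose h : R := (8 * n%:R)^-1; have h0 : 0 < h by rewrite invr_gt0 mulr_gt0.
have nh : (4 * n)%:R * h = 2^-1.
  by rewrite natrM /h; field; rewrite gt_eqF.
have hh : 2^-1 < 2^-1 + h by rewrite ltrDl.
have t0 : 0 <= t.
  by apply: le_trans tK; rewrite !mulr_ge0// invr_ge0 ltW.
pose tau := t * (c * h) / 20.
have tau0 : 0 <= tau by rewrite divr_ge0// mulr_ge0// mulr_ge0// ltW.
have htau : 3 <= tau * (Num.sqrt h / 16) ^+ 4.
  rewrite exprMn (exprM _ 2 2) sqr_sqrtr ?(ltW h0)//.
  have -> : tau * (h ^+ 2 * (16^-1) ^+ 4) = t * c * h ^+ 3 * (20^-1 * (16^-1) ^+ 4).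
    by rewrite /tau; ring.
  apply: (@le_trans _ _ (60 * 16 ^+ 4 * 8 ^+ 3 / c * n%:R ^+ 3 * c * h ^+ 3 *
      (20^-1 * (16^-1) ^+ 4))).
    by rewrite le_eqVlt; apply/predU1P; left; rewrite /h; field; rewrite !gt_eqF.
  by rewrite !ler_wpM2r ?exprn_ge0// ltW.
pose Y (z : mR * T) := tau * sampled h n z.
have Y0 z : 0 <= Y z.
  by rewrite mulr_ge0// sumr_ge0// => k _; exact: sqr_ge0.
have mY : measurable_fun setT Y.
  by apply: measurable_funM => //; exact: measurable_sampled.
have mYw w : measurable_fun setT (fun u : mR => Y (u, w)).
  exact: (measurableT_comp mY (pair2_measurable w)).
have WY w : (\int[uniform_prob hh]_u (Y (u, w))%:E <= (t * rvW B alpha w ^+ 2)%:E)%E.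
  have := @rvW_sqr_ge R d T B alpha cB alpha0 n h hh w nh.
  rewrite -/c => WY.
  have {}WY : ((t * (c * h))%:E * \int[uniform_prob hh]_u
      (\sum_(i < 4 * n) deviation B (clamp01 (u + i%:R * h)) w ^+ 2)%:E <=
      (t * rvW B alpha w ^+ 2)%:E)%E.
    by rewrite (EFinM t (c * h)) -muleA (EFinM t (_ ^+ 2)) lee_wpmul2l// lee_fin.
  apply: le_trans WY.
  have mdev : measurable_fun [set: mR] (fun u : mR =>
      (\sum_(i < 4 * n) deviation B (clamp01 (u + i%:R * h)) w ^+ 2)%:E).
    apply/measurable_EFinP; apply: measurable_sum => i; apply: measurable_funX.
    have mshift : measurable_fun [set: mR] (fun u : mR => (u + i%:R * h : mR, w)).
      apply/measurable_fun_pairP; split; last exact: measurable_cst.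
      by rewrite /comp/=; apply: measurable_funD.
    exact: (measurableT_comp (measurable_deviation cB) mshift).
  have dev0 u : 0 <= \sum_(i < 4 * n) deviation B (clamp01 (u + i%:R * h)) w ^+ 2.
    by apply: sumr_ge0 => i _; exact: sqr_ge0.
  have tch0 : 0 <= t * (c * h) by rewrite !mulr_ge0// ltW.
  rewrite -ge0_integralZl//; last by move=> u _; rewrite lee_fin.
  apply: le_integral_uniform.
  - by apply/measurable_EFinP; exact: mYw.
  - exact: measurable_funeM.
  - by move=> u; rewrite lee_fin.
  - by move=> u; rewrite mule_ge0// lee_fin.
  move=> u /andP[u1 u2]; rewrite -EFinM lee_fin /Y /tau mulrAC -mulrA ler_wpM2l//.
  rewrite mulrC ler_pdivrMl//.
  apply: (@third_diff_sqr_le R (fun i => deviation B (clamp01 (u + i%:R * h)) w)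
    (fun i => B (clamp01 (u + i%:R * h)) w) u h (procM B 1 w) n) => i iN.
  rewrite /deviation {1}/procM clamp01_id//.
  (* With [u <= 2^-1 + h] this gives [u + i%:R * h <= 1]: the grid stays in the unit interval and
     the clamp acts as the identity. *)
  have ih : i.+1%:R * h <= 2^-1 by rewrite -nh ler_pM2r// ler_nat.
  have i0 : 0 <= i%:R * h by rewrite mulr_ge0// ltW.
  have : i.+1%:R * h = i%:R * h + h by rewrite -natr1; ring.
  lra.
have msmp : measurable_fun setT (fun z : mR * T => (expR (- Y z))%:E).
  by apply/measurable_EFinP; apply: measurableT_comp => //; exact: measurableT_comp.
have smp0 (z : mR * T) : (0 <= (expR (- Y z))%:E)%E by rewrite lee_fin expR_ge0.
(* Jensen over the offset [u] for each [w]; Tonelli then exchanges the integrals, so that the bound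
   for a fixed grid applies. *)
apply: (@le_trans _ _ (\int[P]_w \int[uniform_prob hh]_u (expR (- Y (u, w)))%:E)%E).
  apply: ge0_le_integral => //=.
  - apply/measurable_EFinP; apply: measurableT_comp => //.
    apply: measurableT_comp => //; apply: measurable_funM => //.
    by apply: measurable_funX; exact: measurable_rvW.
  - have mG : measurable_fun setT (fubini_G (uniform_prob hh)
        (fun z : mR * T => (expR (- Y z))%:E)).
      exact: measurable_fun_fubini_tonelli_G.
    exact: mG.
  move=> w _; apply: le_trans (expR_mean_le (mYw w) _ _) => //.
  - rewrite lee_fin ler_expR lerN2 -lee_fin fineK//.
    rewrite ge0_fin_numE; last by apply: integral_ge0 => u _; rewrite lee_fin.
    by apply: (le_lt_trans (WY w)); rewrite ltry.
  - by apply: (le_lt_trans (WY w)); rewrite ltry.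
rewrite -(fubini_tonelli _ msmp smp0).
apply: (@le_trans _ _ (\int[uniform_prob hh]_u (cst (2^-1 ^+ n)%:E u))%E).
  apply: le_integral_uniform => //.
  - have mF : measurable_fun setT (fubini_F P
        (fun z : mR * T => (expR (- Y z))%:E)).
      exact: measurable_fun_fubini_tonelli_F.
    exact: mF.
  - by move=> u; apply: integral_ge0.
  - by move=> u; rewrite lee_fin exprn_ge0// invr_ge0.
  move=> u /andP[u1 u2]; apply: expectation_sampled_le => //.
    by apply: lt_le_trans u1; rewrite invr_gt0.
  by rewrite nh; lra.
rewrite integral_cst//= (_ : uniform_prob _ _ = 1%E) ?mule1//.
exact: (@probability_setT _ _ _ (uniform_prob hh)).
Qed.

End brownian.

(** * Asymptotics *)

(** The standard density is compared with that of deviation 2: the peaks have ratio 2, and on the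
    tail [x^2 / 2 >= a / 4 + x^2 / 8]. The wider law has total mass 1. *)
Lemma normal_prob_tail_le (R : realType) (a : R) :
  (normal_prob 0 1 [set x : R | (a <= x ^+ 2)%R] <= (2 * expR (- (a / 4)))%:E)%E.
Proof.
have mS : measurable ([set x | a <= x ^+ 2] : set (measurableTypeR R)).
  have -> : [set x | a <= x ^+ 2] =
      (fun x : measurableTypeR R => x ^+ 2) @^-1` `[a, +oo[.
    by apply/seteqP; split => x /=; rewrite in_itv/= andbT.
  by rewrite -[X in measurable X]setTI; apply: measurable_funX.
set S := [set x | _] in mS *.
have c0 : 0 <= 2 * expR (- (a / 4)) by rewrite mulr_ge0// expR_ge0.
have m2 : measurable_fun S (fun x : R => (normal_pdf 0 2 x)%:E).
  by apply/measurable_EFinP/measurable_funTS; exact: measurable_normal_pdf.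
apply: (@le_trans _ _ (\int[lebesgue_measure]_(x in S)
    ((2 * expR (- (a / 4)))%:E * (normal_pdf 0 2 x)%:E))%E).
  apply: ge0_le_integral => //=.
  - by move=> x _; rewrite lee_fin normal_pdf_ge0.
  - by apply/measurable_EFinP/measurable_funTS; exact: measurable_normal_pdf.
  - exact: measurable_funeM.
  move=> x; rewrite /S/= => ax; rewrite -EFinM lee_fin.
  rewrite !normal_pdfE ?oner_neq0 ?pnatr_eq0// /normal_fun.
  have -> : normal_peak 1 = 2 * normal_peak 2 :> R.
    rewrite /normal_peak.
    have -> : 2 ^+ 2 * pi *+ 2 = 2 ^+ 2 * (1 ^+ 2 * pi *+ 2) :> R.
      by rewrite expr1n mul1r mulrnAr.
    rewrite [in RHS]sqrtrM ?sqr_ge0// sqrtr_sqr ger0_norm// invfM mulrA mulfV//.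
    by rewrite mul1r.
  rewrite -!mulrA ler_wpM2l// mulrCA ler_wpM2l ?normal_peak_ge0//.
  have -> : 1 ^+ 2 *+ 2 = 2 :> R by rewrite expr1n.
  have -> : 2 ^+ 2 *+ 2 = 8 :> R by rewrite -natrX -mulrnA.
  rewrite -expRD ler_expR subr0.
  by move: (x ^+ 2) (sqr_ge0 (x : R)) ax => y y0 ay; lra.
rewrite ge0_integralZl//; last by move=> x _; rewrite lee_fin normal_pdf_ge0.
rewrite -[leRHS]mule1 lee_wpmul2l ?lee_fin//.
exact: (@probability_le1 _ _ _ (normal_prob 0 2)).
Qed.

Lemma measurable_set_lt (R : realType) (d : measure_display)
    (T : measurableType d) (f g : T -> R) :
  measurable_fun setT f -> measurable_fun setT g ->
  measurable [set w | f w < g w].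
Proof.
move=> mf mg; have -> : [set w | f w < g w] = (g \- f) @^-1` `]0, +oo[.
  by apply/seteqP; split => w /=; rewrite in_itv/= andbT subr_gt0.
by rewrite -[X in measurable X]setTI; apply: measurable_funB.
Qed.

(** Exponential Markov inequality: on the event the integrand is at least [expR (- (s * a))]. *)
Lemma probability_lt_le_expR (R : realType) (d : measure_display)
    (T : measurableType d) (P : probability T R) (Y : T -> R) (s a c : R) :
  measurable_fun setT Y -> 0 <= s ->
  (\int[P]_w (expR (- (s * Y w)))%:E <= c%:E)%E ->
  (P [set w | (Y w < a)%R] <= (expR (s * a) * c)%:E)%E.
Proof.
move=> mY s0 hc; set A := [set w | _].
have mA : measurable A by exact: measurable_set_lt.
have key : ((expR (- (s * a)))%:E * P A <= c%:E)%E.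
  apply: le_trans hc; rewrite -[X in (_ * P X)%E]setIT -integral_indic//.
  rewrite -ge0_integralZl//; last first.
    by apply/measurable_EFinP; exact: measurable_indic.
  apply: ge0_le_integral => //=.
  - by apply: measurable_funeM; apply/measurable_EFinP; exact: measurable_indic.
  - apply/measurable_EFinP; apply: measurableT_comp => //.
    by apply: measurableT_comp => //; exact: measurable_funM.
  move=> w _; rewrite -EFinM lee_fin indicE.
  have [wA|_] := boolP (w \in A); last by rewrite mulr0 expR_ge0.
  rewrite mulr1 ler_expR lerN2 ler_wpM2l//.
  by move: wA; rewrite inE => /ltW.
have -> : P A = ((expR (s * a))%:E * ((expR (- (s * a)))%:E * P A))%E.
  by rewrite muleA -EFinM -expRD addrN expR0 mul1e.
by rewrite EFinM lee_wpmul2l// lee_fin expR_ge0.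
Qed.

Lemma half_le_expR (R : realType) (n : nat) :
  2^-1 ^+ n <= expR (- (n%:R / 2)) :> R.
Proof.
have -> : - (n%:R / 2) = n%:R * - 2^-1 :> R by ring.
rewrite expRM_natl lerXn2r ?nnegrE ?expR_ge0//.
by apply: le_trans (expR_ge1Dx _); lra.
Qed.

(** This pays for rounding: replacing a real [x] by its integer part in [expR (- (x / 2))] costs at
    most a factor [expR 2^-1]. *)
Lemma expR_half_le2 (R : realType) : expR (2^-1) <= 2 :> R.
Proof.
rewrite -[leLHS]invrK -expRN -[leRHS]invrK lef_pV2 ?posrE ?expR_gt0 ?invr_gt0//.
by apply: le_trans (expR_ge1Dx _); lra.
Qed.

Lemma powR_invnX (R : realType) (t : R) (m : nat) : 0 <= t ->
  (t `^ m.+1%:R^-1) ^+ m.+1 = t.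
Proof.
by move=> t0; rewrite -powR_mulrn ?powR_ge0// -powRrM mulVf// powRr1.
Qed.

Lemma le_powR_invn (R : realType) (L t : R) (m : nat) : 0 <= L ->
  L ^+ m.+1 <= t -> L <= t `^ m.+1%:R^-1.
Proof.
move=> L0 Lt; have t0 : 0 <= t by rewrite (le_trans _ Lt)// exprn_ge0.
rewrite -(@ler_pXn2r _ m.+1) ?nnegrE ?powR_ge0//.
by rewrite powR_invnX.
Qed.

(** * The two bounds for large [t] *)

Section brownian_functionals.
Context (R : realType) (d : measure_display) (T : measurableType d)
  (P : probability T R) (B : R -> {RV P >-> R}).
Hypothesis hB : standard_brownian_motion01 P B.

Lemma brownian_sqr_tail_le (a : R) :
  (P [set w | (a <= B 1 w ^+ 2)%R] <= (2 * expR (- (a / 4)))%:E)%E.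
Proof.
have [N [mN PN BN]] := brownian_start hB.
pose D : {RV P >-> R} := B 1 \- B 0.
pose S := [set x : R | (a <= x ^+ 2)%R].
have mS : measurable S.
  have -> : S = (fun x : R => x ^+ 2) @^-1` `[a, +oo[.
    by apply/seteqP; split => x /=; rewrite in_itv/= andbT.
  by rewrite -[X in measurable X]setTI; apply: measurable_funX.
have mDS : measurable (D @^-1` S) by exact: measurable_funPTI.
apply: (@le_trans _ _ (P (D @^-1` S `|` N))).
  apply: le_measure; rewrite ?inE.
  - have -> : [set w | a <= B 1 w ^+ 2] = B 1 @^-1` S by [].
    exact: measurable_funPTI.
  - exact: measurableU.
  move=> w /= aB; have [B0|B0] := eqVneq (B 0 w) 0.
    by left; rewrite /S/= B0 subr0.
  by right; apply: BN => /=; exact/eqP.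
apply: (le_trans (measureU2 P mDS mN)); rewrite /= PN adde0.
have := brownian_increment hB (lexx 0) ltr01 (lexx 1) mS.
rewrite subr0 sqrtr1 => h.
apply: le_trans (normal_prob_tail_le a).
by rewrite -[leRHS]h.
Qed.

Lemma expectation_expR_rvW_asymptotic (alpha : R) : 1 <= alpha ->
  \forall t \near +oo,
    ('E_P[fun w => expR (- t * rvW B alpha w ^+ 2)]
       <= (9 * expR (- constC alpha * t `^ (1 / 4)))%:E)%E.
Proof.
move=> alpha1; have alpha0 : 0 <= alpha by lra.
pose K : R := 60 * 16 ^+ 4 * 8 ^+ 3 / 2^-1 `^ alpha.
have K0 : 0 <= K by rewrite divr_ge0// powR_ge0.
(* Beyond this threshold [x = t^(1/4)] is at least [1 + K]. Its integer part [n] is then positive,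
   and [K * n^3 <= x * x^3 = t]. *)
exists ((1 + K) ^+ 4); split; first exact: num_real.
move=> t Lt; have t0 : 0 <= t by rewrite (le_trans _ (ltW Lt))// exprn_ge0// addr_ge0.
pose x := t `^ 4^-1.
have Lx : 1 + K <= x by apply: le_powR_invn (ltW Lt); rewrite addr_ge0.
have xt : x ^+ 4 = t by exact: powR_invnX.
have x0 : 0 <= x by rewrite powR_ge0.
pose n := Num.truncn x.
have /andP[nx xn] := truncn_itv x0; rewrite -/n in nx xn.
have n0 : (0 < n)%N by rewrite truncn_gt0; lra.
have Kn : K * n%:R ^+ 3 <= t.
  have n3 : n%:R ^+ 3 <= x ^+ 3 by rewrite lerXn2r// nnegrE.
  have Kx : K <= x by lra.
  by rewrite -xt (exprS x 3) ler_pM// exprn_ge0.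
rewrite unlock; under eq_integral do rewrite mulNr.
apply: (le_trans (expectation_expR_rvW_le hB alpha0 n0 Kn)).
rewrite lee_fin (le_trans (half_le_expR _ _))//.
have -> : t `^ (1 / 4) = x by rewrite /x div1r.
have C0 : constC alpha <= 2^-1.
  by rewrite /constC lef_pV2 ?posrE; lra.
apply: (@le_trans _ _ (expR (2^-1 + - (constC alpha * x)))).
  have : constC alpha * x <= 2^-1 * x by rewrite ler_wpM2r.
  by rewrite ler_expR; move: xn; rewrite -natr1; lra.
rewrite expRD mulNr ler_wpM2r ?expR_ge0//.
by apply: (le_trans (expR_half_le2 R)); lra.
Qed.

(** The base [constC alpha / 4] is at most [1 / 256], and an exponent above 1 only decreases it. The
    crude value [1 / 8] is the rate required in the tail estimate for [rvH]. *)
Lemma constD_le (alpha : R) : 1 <= alpha -> constD alpha <= 8^-1.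
Proof.
move=> alpha1; rewrite /constD.
have C0 : 0 < constC alpha / 4 by rewrite divr_gt0// invr_gt0; lra.
have C1 : constC alpha / 4 <= 256^-1.
  have : constC alpha <= 64^-1 by rewrite /constC lef_pV2 ?posrE; lra.
  lra.
have -> : 4 / 3 = 1 + 3^-1 :> R by field.
rewrite powRD; last by rewrite (gt_eqF C0) implybT.
rewrite powRr1 ?(ltW C0)//.
have : (constC alpha / 4) `^ 3^-1 <= 1.
  apply: (@le_trans _ _ (1 `^ 3^-1)); last by rewrite powR1.
  by rewrite ge0_ler_powR// ?nnegrE; lra.
move=> h; have : constC alpha / 4 * (constC alpha / 4) `^ 3^-1 <= constC alpha / 4.
  by rewrite ler_piMr// ltW.
lra.
Qed.

Lemma probability_rvH_asymptotic (alpha : R) : 1 <= alpha ->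
  \forall t \near +oo,
    (P [set w | (t < `|rvH B alpha w|)%R]
       <= (11 * expR (- constD alpha * t `^ (2 / 5)))%:E)%E.
Proof.
move=> alpha1; have alpha0 : 0 <= alpha by lra.
pose K : R := 60 * 16 ^+ 4 * 8 ^+ 3 / 2^-1 `^ alpha.
have K0 : 0 <= K by rewrite divr_ge0// powR_ge0.
exists ((2 + 8 * K) ^+ 10); split; first exact: num_real.
have L0 : 0 <= 2 + 8 * K by rewrite addr_ge0// mulr_ge0.
move=> t Lt; have t0 : 0 < t by apply: le_lt_trans Lt; rewrite exprn_ge0.
(* The scales become integer powers of [v]: [t^(2/5) = v^4] and [t^(1/2) = v^5]. The threshold gives
   [v >= 2] and [8 * K <= v^2]. *)
pose v := t `^ 10^-1.
have Lv : 2 + 8 * K <= v by apply: le_powR_invn (ltW Lt).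
have vt : v ^+ 10 = t by apply: powR_invnX; exact: ltW.
have v0 : 0 < v by lra.
have v1 : 1 <= v by lra.
have v2 : 8 * K <= v ^+ 2 by rewrite expr2; nra.
have -> : t `^ (2 / 5) = v ^+ 4.
  by rewrite -powR_mulrn ?ltW// -powRrM; congr (_ `^ _); field.
have v4 : 1 <= v ^+ 4 by rewrite exprn_ege1.
have v45 : v ^+ 4 <= v ^+ 5 by rewrite ler_weXn2l.
have v5 : 1 < v ^+ 5 by rewrite exprn_egt1//; lra.
pose n := Num.truncn (v ^+ 4).
have /andP[nx xn] := truncn_itv (ltW (lt_le_trans ltr01 v4)); rewrite -/n in nx xn.
have n0 : (0 < n)%N by rewrite truncn_gt0.
(* The smallest parameter at which the Laplace bound yields [2^-n], with [n] the integer part of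
   [t^(2/5)]. *)
pose s := K * n%:R ^+ 3.
have s0 : 0 <= s by rewrite mulr_ge0// exprn_ge0.
pose W := rvW B alpha.
have mW : measurable_fun setT W by exact: (measurable_rvW alpha (brownian_continuous hB)).
have mM : measurable_fun setT (procM B 1).
  by apply: measurable_funB => //; apply: measurable_funX; exact: measurable_funPT.
have W0 w : 0 <= W w by exact: sqrtr_ge0.
(* By the convention [x / 0 = 0], a zero of [W] cannot give [t < |H|] since [t > 0]; the event thus
   forces [0 < W w], and the quotient can be cleared. *)
have HE : [set w | t < `|rvH B alpha w|] =
    [set w | 0 < W w] `&` [set w | t * W w < `|procM B 1 w|].
  apply/seteqP; split => w /=; rewrite /rvH -/(W w) normrM normfV (ger0_norm (W0 w)).
    move=> tH; have Wp : 0 < W w.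
      rewrite lt_neqAle W0 andbT; apply/eqP => Wz; move: tH.
      by rewrite -Wz invr0 mulr0 ltNge ltW.
    by split => //; rewrite -ltr_pdivlMr.
  by move=> [Wp tW]; rewrite ltr_pdivlMr.
pose A1 := [set w | (v ^+ 5 <= B 1 w ^+ 2)%R].
pose A2 := [set w | (W w ^+ 2 < v ^- 10)%R].
have mA1 : measurable A1.
  have -> : A1 = ~` [set w | B 1 w ^+ 2 < v ^+ 5].
    by apply/seteqP; split => w; rewrite /A1/= leNgt => /negP.
  apply: measurableC; apply: measurable_set_lt => //.
  by apply: measurable_funX; exact: measurable_funPT.
have mA2 : measurable A2.
  by apply: measurable_set_lt => //; exact: measurable_funX.
have mH : measurable [set w | t < `|rvH B alpha w|].
  rewrite HE; apply: measurableI; first exact: measurable_set_lt.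
  by apply: measurable_set_lt; [exact: measurable_funM|exact: measurableT_comp].
(* If [B 1 w ^+ 2 < v^5], then [|M(1)| < v^5] because [v^5 > 1], so [W < v^5 / t = v^-5]. *)
have sub : [set w | t < `|rvH B alpha w|] `<=` A1 `|` A2.
  rewrite HE => w /= [Wp tW].
  have [?|B5] := leP (v ^+ 5) (B 1 w ^+ 2); [by left|right].
  have M5 : `|procM B 1 w| < v ^+ 5.
    rewrite /procM ltr_norml; have := sqr_ge0 (B 1 w); lra.
  have {}tW : v ^+ 5 * W w < 1.
    have := lt_trans tW M5; rewrite -vt -[X in _ < X]mulr1 (exprD v 5 5) -mulrA.
    by rewrite ltr_pM2l// exprn_gt0.
  rewrite /A2/= -[X in _ < X]mul1r ltr_pdivlMr ?exprn_gt0//.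
  have -> : W w ^+ 2 * v ^+ 10 = (v ^+ 5 * W w) ^+ 2 by ring.
  by rewrite expr_lt1// mulr_ge0// exprn_ge0// ltW.
apply: (@le_trans _ _ (P (A1 `|` A2))).
  by apply: le_measure; rewrite ?inE//; exact: measurableU.
apply: (le_trans (measureU2 P mA1 mA2)).
have PA1 := brownian_sqr_tail_le (v ^+ 5).
have PA2 : (P A2 <= (expR (s * v ^- 10) * 2^-1 ^+ n)%:E)%E.
  apply: probability_lt_le_expR => //; first exact: measurable_funX.
  exact: expectation_expR_rvW_le.
apply: (le_trans (leeD PA1 PA2)); rewrite -EFinD lee_fin mulNr.
have Dle := constD_le alpha1.
have Dv : constD alpha * v ^+ 4 <= 8^-1 * v ^+ 4 by rewrite ler_wpM2r//; lra.
have E1 : expR (- (v ^+ 5 / 4)) <= expR (- (constD alpha * v ^+ 4)).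
  by rewrite ler_expR; lra.
(* From [n^3 <= v^12] and [K <= v^2 / 8]. The Markov factor loses only [v^4 / 8] in the exponent,
   against a gain of about [v^4 / 2] from [2^-n]. *)
have sv : s * v ^- 10 <= v ^+ 4 / 8.
  rewrite ler_pdivrMr ?exprn_gt0//.
  have n12 : n%:R ^+ 3 <= (v ^+ 4) ^+ 3 by rewrite lerXn2r// nnegrE; lra.
  apply: (@le_trans _ _ (v ^+ 2 / 8 * (v ^+ 4) ^+ 3)).
    by rewrite ler_pM ?exprn_ge0//; lra.
  by rewrite le_eqVlt; apply/predU1P; left; field.
have E2 : expR (s * v ^- 10) * 2^-1 ^+ n <= 2 * expR (- (constD alpha * v ^+ 4)).
  apply: (@le_trans _ _ (expR (s * v ^- 10) * expR (- (n%:R / 2)))).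
    by rewrite ler_wpM2l ?expR_ge0// half_le_expR.
  apply: (@le_trans _ _ (expR (2^-1 + - (constD alpha * v ^+ 4)))).
    by rewrite -expRD ler_expR; move: xn; rewrite -natr1; lra.
  rewrite expRD ler_wpM2r ?expR_ge0//.
  exact: expR_half_le2.
(* The two events contribute a factor 2 each, and [2 + 2 <= 11]. *)
apply: le_trans (lerD (ler_wpM2l _ E1) E2) _ => //.
by rewrite -mulrDl ler_wpM2r ?expR_ge0// -natrD ler_nat.
Qed.

End brownian_functionals.

Theorem lemmaA2 (R : realType) (d : measure_display) (T : measurableType d)
    (P : probability T R) (B : R -> {RV P >-> R})
    (hB : standard_brownian_motion01 P B) (alpha : R) (halpha : 1 <= alpha) :
  \forall t \near +oo,
    ('E_P[fun w => expR (- t * rvW B alpha w ^+ 2)]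
       <= (9 * expR (- constC alpha * t `^ (1 / 4)))%:E)%E /\
    (P [set w | (t < `|rvH B alpha w|)%R]
       <= (11 * expR (- constD alpha * t `^ (2 / 5)))%:E)%E.
Proof.
have := probability_rvH_asymptotic hB halpha.
by apply: filterS2 (expectation_expR_rvW_asymptotic hB halpha).
Qed.
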